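(* Let $(I,\le)$ be a directed set, let $U\subseteq C$, and let $Z$ and $Z_\alpha$, $\alpha\in I$, be convex stochastic processes in $U$ defined on a complete probability space $(\Omega,\mathcal{A},\mathbb{P})$. Assume that $Z_\alpha(t)\to Z(t)$ a.s. for every $t\in D$, where $D$ is a countable dense subset of $\mathbb{R}$. Then: (1) If $U=S$, then $\liminf_\alpha\sigma(Z_\alpha)\ge\sigma(Z)$ a.s. (2) If $U=S'$, then $\limsup_\alpha\tau(Z_\alpha)\le\tau(Z)$ a.s. (3) If $U=S^*$ and $Z\in S_u$ a.s., then $\lim_\alpha\sigma(Z_\alpha)=\sigma(Z)=\tau(Z)$ a.s. and $\lim_\alpha\tau(Z_\alpha)=\tau(Z)=\sigma(Z)$ a.s. (4) If $U=S^*$ and $\xi:S^*\to\mathbb{R}$ is any measurable selection of $A$, then $\liminf_\alpha\xi(Z_\alpha)\ge\sigma(Z)$ a.s. and $\limsup_\alpha\xi(Z_\alpha)\le\tau(Z)$ a.s. If in addition $Z\in S_u$ a.s., then $\lim_\alpha\xi(Z_\alpha)=\sigma(Z)=\tau(Z)$ a.s.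
   Context: $C$ is the set of all convex functions $f:\mathbb{R}\to\mathbb{R}$; $A(f)=\{t\in\mathbb{R}: f(t)=\inf_{s\in\mathbb{R}} f(s)\}$. $S=\{f\in C: A(f)\neq\emptyset,\ \inf A(f)>-\infty\}$, $S'=\{f\in C: A(f)\ne\emptyset,\ \sup A(f)<\infty\}$, $S^*=S\cap S'$, $S_u=\{f\in C: f\text{ has a unique minimizing point}\}$; $\sigma(f)=\min A(f)$ for $f\in S$ and $\tau(f)=\max A(f)$ for $f\in S'$. $\mathcal{C}$ is the $\sigma$-algebra on $C$ generated by the evaluations $f\mapsto f(t)$, $t\in\mathbb{R}$. A measurable selection of $A$ is a map $\xi:S^*\to\mathbb{R}$ that is Borel measurable with respect to the trace $\sigma$-algebra $S^*\cap\mathcal{C}$ and satisfies $\xi(f)\in A(f)$ for all $f\in S^*$. A convex stochastic process is a map $Z:\Omega\to C$ such that $Z(t):\omega\mapsto Z(\omega)(t)$ is a real random variable for every $t\in\mathbb{R}$; it is a process in $U\subseteq C$ if $Z(\omega)\in U$ for all $\omega\in\Omega$. For a real net, $\liminf_\alpha y_\alpha=\sup_{\alpha}\inf_{\beta\ge\alpha}y_\beta$ and $\limsup_\alpha y_\alpha=\inf_\alpha\sup_{\beta\ge\alpha}y_\beta$, in $[-\infty,\infty]$. ''$Z_\alpha(t)\to Z(t)$ a.s.'' means that the set of $\omega$ for which the net $(Z_\alpha(\omega)(t))_{\alpha\in I}$ converges to $Z(\omega)(t)$ has probability one. *)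

(* Defs.v *)
From HB Require Import structures.
From mathcomp Require Import all_boot all_order all_algebra.
From mathcomp Require Import all_classical all_reals all_analysis.

Set Implicit Arguments.
Unset Strict Implicit.
Unset Printing Implicit Defensive.

Import Order.TTheory GRing.Theory Num.Theory.
Import numFieldNormedType.Exports.

Local Open Scope classical_set_scope.
Local Open Scope ring_scope.

Section ConvexFunctions.
Context {R : realType}.
Implicit Types (f : R -> R) (A : set R).

Definition convex_functions : set (R -> R) :=
  [set f | convex_function [set: R^o] f].

(* The infimum is taken in the extended reals, so the set is empty when [f] is
   unbounded below. *)
Definition argmin f : set R :=
  [set t | (f t)%:E = ereal_inf [set (f s)%:E | s in [set: R]]].

Definition cvxS : set (R -> R) :=
  [set f | [/\ convex_functions f, argmin f !=set0 &
               (-oo < ereal_inf [set t%:E | t in argmin f])%E]].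

Definition cvxS' : set (R -> R) :=
  [set f | [/\ convex_functions f, argmin f !=set0 &
               (ereal_sup [set t%:E | t in argmin f] < +oo)%E]].

Definition cvxSstar : set (R -> R) := cvxS `&` cvxS'.

Definition cvxSu : set (R -> R) :=
  [set f | convex_functions f /\ exists! t, argmin f t].

(* Least and greatest elements, with default value 0 when there is none. *)
Definition set_min A : R := xget 0 (A `&` lbound A).
Definition set_max A : R := xget 0 (A `&` ubound A).

Definition argmin_min f : R := set_min (argmin f).
Definition argmin_max f : R := set_max (argmin f).

(* The sigma-algebra is one of subsets of [convex_functions], not of the whole
   type [R -> R]. *)
Definition eval_sigma_algebra : set (set (R -> R)) :=
  <<s convex_functions,
      [set X | exists t, exists2 B : set R, measurable B &
               X = convex_functions `&` [set f | B (f t)]] >>.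

(* A map from [cvxSstar] to the reals is encoded by a function on all of
   [R -> R] whose values outside [cvxSstar] are irrelevant: only its restriction
   is required to be measurable, for the trace sigma-algebra on [cvxSstar]. *)
Definition measurable_selection (xi : (R -> R) -> R) : Prop :=
  (forall B : set R, measurable B ->
     strace eval_sigma_algebra cvxSstar (cvxSstar `&` xi @^-1` B)) /\
  (forall f, cvxSstar f -> argmin f (xi f)).

End ConvexFunctions.

Section Nets.
Context {I : Type} (le : I -> I -> Prop).

Definition directed : Prop :=
  [/\ [set: I] !=set0,
      forall a, le a a,
      forall a b c, le a b -> le b c -> le a c &
      forall a b, exists c, le a c /\ le b c].

(* The filter of eventual sets: a net [y] converges to [l] when
   [y a @[a --> net_filter] --> l]. *)
Definition net_filter : set_system I :=
  filter_from [set: I] (fun a => [set b | le a b]).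

Definition net_liminf {R : realType} (y : I -> R) : \bar R :=
  ereal_sup [set ereal_inf [set (y b)%:E | b in [set b | le a b]]
            | a in [set: I]].

Definition net_limsup {R : realType} (y : I -> R) : \bar R :=
  ereal_inf [set ereal_sup [set (y b)%:E | b in [set b | le a b]]
            | a in [set: I]].

End Nets.

Section Processes.
Context {d : measure_display} {Omega : measurableType d} {R : realType}.

(* The event itself has to be measurable; for a complete [P] this is the same
   as [{ae P, forall w, E w}]. *)
Definition almost_surely (P : probability Omega R) (E : set Omega) : Prop :=
  measurable E /\ P E = 1%E.

Definition convex_process (Z : Omega -> R -> R) : Prop :=
  (forall w, convex_functions (Z w)) /\
  (forall t, measurable_fun [set: Omega] (fun w => Z w t)).

Definition process_in (U : set (R -> R)) (Z : Omega -> R -> R) : Prop :=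
  convex_process Z /\ forall w, U (Z w).

End Processes.

(* Main.v *)
Require Import Defs.
From mathcomp Require Import all_boot all_order all_algebra.
From mathcomp Require Import all_classical all_reals all_analysis.
From mathcomp Require Import lra ring.

(** The measure theory only provides one event: since [D] is countable, almost
    every [w] is such that [Za a w t] converges to [Z w t] for all [t] in [D] at
    once ([ae_countable]); on a complete space every superset of that event is
    itself measurable with probability one ([almost_surelyP]), so all remaining
    reasoning is about fixed convex functions.

    The deterministic core is [near_argmin_gt].  Let [s] be the least minimizer
    of [f] and [t < s].  Choose [u < v] in [D] between [t] and [s].  As [u] is
    left of every minimizer, [f u > f s], and convexity makes [f] strictly
    decrease from [u] to [v].  Pointwise convergence at these two points gives
    [fa a u > fa a v] eventually, and a convex function which strictly decreases
    from [u] to [v] has all its minimizers right of [u], hence of [t].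
    Reflecting the real line turns this into the statement on greatest
    minimizers, [near_argmin_lt].

    Both bounds hold for all minimizers of [fa a] simultaneously, so they apply
    to the least one, the greatest one and any selection, which gives the
    liminf and limsup inequalities.  When the minimizer of the limit is unique
    the two bounds coincide and squeeze every selection. *)

Import Order.TTheory GRing.Theory Num.Theory.
Import numFieldNormedType.Exports.

Local Open Scope classical_set_scope.
Local Open Scope ring_scope.

(** * Minimizers of convex functions *)

Section ConvexMinimizers.
Context {R : realType}.
Implicit Types (f : R -> R) (s t x y z : R).

(** The convexity inequality cleared of its denominator, which leaves polynomial
    goals and makes the degenerate case [x = z] harmless. *)
Lemma convex_chord f x y z : convex_functions f -> x <= y -> y <= z ->
  (z - x) * f y <= (z - y) * f x + (y - x) * f z.
Proof.
move=> cf xy yz; have [xz|zx] := ltP x z; last first.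
  have [-> ->] : x = y /\ z = y by split; lra.
  by rewrite !subrr !mul0r addr0.
have zx0 : 0 < z - x by rewrite subr_gt0.
have [l lE] : exists l : {i01 R}, l%:num = (z - y) / (z - x).
  have lP : Itv.spec (@Itv.num_sem R) (Itv.Real `[0, 1]%Z) ((z - y) / (z - x)).
    rewrite /Itv.spec/= /Itv.num_sem/= num_real/= in_itv/=.
    by rewrite divr_ge0 ?subr_ge0 ?(ltW xz)//= ler_pdivrMr// mul1r; lra.
  by exists (Itv.mk lP).
have : f (l%:num * x + (1 - l%:num) * z) <= l%:num * f x + (1 - l%:num) * f z.
  by apply: cf; rewrite inE.
rewrite !lE.
have -> : (z - y) / (z - x) * x + (1 - (z - y) / (z - x)) * z = y.
  by field; rewrite gt_eqF.
rewrite -(ler_pM2l zx0) => /le_trans; apply.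
rewrite le_eqVlt; apply/orP; left; apply/eqP.
by field; rewrite gt_eqF.
Qed.

Lemma argminP f t : argmin f t <-> forall s, f t <= f s.
Proof.
split=> [ft s|ft].
  by rewrite -lee_fin ft; apply: ereal_inf_lbound; exists s.
apply/eqP; rewrite eq_le; apply/andP; split.
  by apply/ereal_infP => _ [s _ <-]; rewrite lee_fin.
by apply: ereal_inf_lbound; exists t.
Qed.

Lemma convex_functions_opp f :
  convex_functions f -> convex_functions (f \o -%R).
Proof.
move=> cf l x y _ _ /=.
by rewrite convN; apply: cf; rewrite inE.
Qed.

Lemma argmin_opp f t : argmin (f \o -%R) t <-> argmin f (- t).
Proof.
rewrite !argminP/=; split=> ft s; last exact: ft.
by have := ft (- s); rewrite opprK.
Qed.

Lemma cvxS_opp f : cvxS' f -> cvxS (f \o -%R).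
Proof.
move=> [cf [t ft] supf]; split; first exact: convex_functions_opp.
  by exists (- t); apply/argmin_opp; rewrite opprK.
have -> : [set t%:E | t in argmin (f \o -%R)] =
          [set (- x)%E | x in [set t%:E | t in argmin f]].
  apply/seteqP; split => [_ [u fu <-]|_ [_ [u fu <-] <-]].
    by exists (- u)%:E; [exists (- u) => //; exact/argmin_opp|rewrite EFinN oppeK].
  by exists (- u) => //; apply/argmin_opp; rewrite opprK.
by rewrite ereal_infN lteNr.
Qed.

(** With [m] the infimum of the minimizers and [v] the minimal value, suppose
    [f m > v].  The chord from [m - 1] to a minimizer [a > m] lies above the
    graph at [m]; as [a] tends to [m] its height there tends to [v], a
    contradiction. *)
Lemma cvxS_has_min f : cvxS f -> exists s, (argmin f `&` lbound (argmin f)) s.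
Proof.
move=> [cf [a0 fa0] infNy].
have has_lb : has_lbound (argmin f).
  move: infNy.
  case: (ereal_inf _) (@ereal_inf_lbound R [set t%:E | t in argmin f])
    => [r| |] //= lb _.
    by exists r => t ft; rewrite -lee_fin; apply: lb; exists t.
  by have /(_ (ex_intro2 _ _ _ fa0 erefl)) := lb a0%:E; rewrite leye_eq.
pose m := inf (argmin f).
exists m; split; last exact: ge_inf.
apply/argminP => s; apply: (@le_trans _ _ (f a0)); last by move/argminP: fa0.
rewrite leNgt; apply/negP => fm.
(* [M] bounds the slope of descent of [f] from [m - 1] to [m], so a minimizer
   closer to [m] than [(f m - f a0) / M] contradicts the chord inequality. *)
pose M := `|f (m - 1) - f m| + 1.
have M0 : 0 < M by rewrite ltr_wpDl.
have c0 : 0 < f m - f a0 by rewrite subr_gt0.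
have /inf_adherent : 0 < (f m - f a0) / M by rewrite divr_gt0.
move=> /(_ (argmin f))[|a fa]; first by split => //; exists a0.
rewrite -/m -ltrBlDl ltr_pdivlMr// => am.
have ma : m <= a by exact: ge_inf.
have faE : f a = f a0.
  by apply/le_anti/andP; split; [move/argminP: fa|move/argminP: fa0].
have := @convex_chord f (m - 1) m a cf _ ma.
rewrite faE => /(_ ltac:(lra)).
have : f (m - 1) - f m <= M by rewrite (le_trans (ler_norm _))// lerDl.
have : 0 <= a - m by lra.
move: am c0; clearbody M m; nra.
Qed.

Lemma argmin_minP f : cvxS f ->
  argmin f (argmin_min f) /\ lbound (argmin f) (argmin_min f).
Proof. by move=> /cvxS_has_min/(xgetPex 0). Qed.

Lemma argmin_maxP f : cvxS' f ->
  argmin f (argmin_max f) /\ ubound (argmin f) (argmin_max f).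
Proof.
move=> /cvxS_opp/cvxS_has_min[s [fs lb]].
apply: (@xgetPex _ 0 (argmin f `&` ubound (argmin f))); exists (- s).
split=> [|t ft]; first exact/argmin_opp.
by rewrite lerNr; apply: lb; apply/argmin_opp; rewrite opprK.
Qed.

Lemma argmin_min_max_unique f : cvxSstar f -> cvxSu f ->
  argmin_min f = argmin_max f.
Proof.
move=> [/argmin_minP[fmin _] /argmin_maxP[fmax _]] [_ [t [_ tP]]].
by rewrite -(tP _ fmin) -(tP _ fmax).
Qed.

Lemma dense_itv (D : set R) x y : dense D -> x < y ->
  exists2 t, D t & x < t < y.
Proof.
move=> D_dense xy.
have [||t [/= txy Dt]] := D_dense `]x, y[%classic.
- by exists ((x + y) / 2); rewrite /= in_itv/=; apply/andP; split; lra.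
- exact: itv_open.
by exists t => //; move: txy; rewrite in_itv.
Qed.

(** The density of [D] enters as the existence of points of [D] between any two
    reals, a form which passes to the reflected set in [near_argmin_lt]. *)
Lemma near_argmin_gt {T : Type} (F : set_system T) {FF : Filter F}
    (D : set R) f (fa : T -> R -> R) s t :
  (forall x y, x < y -> exists2 u, D u & x < u < y) ->
  convex_functions f -> (forall a, convex_functions (fa a)) ->
  (forall u, D u -> fa a u @[a --> F] --> f u) ->
  argmin f s -> lbound (argmin f) s -> t < s ->
  \forall a \near F, forall m, argmin (fa a) m -> t < m.
Proof.
move=> D_btw cf cfa fa_cvg fs lbs ts.
have [u Du /andP[tu us]] := D_btw _ _ ts.
have [v Dv /andP[uv vs]] := D_btw _ _ us.
have fsu : f s < f u.
  rewrite ltNge; apply/negP => fus.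
  suff /lbs : argmin f u by lra.
  by apply/argminP => r; apply: (le_trans fus); move/argminP: fs.
have fvu : f v < f u.
  have := convex_chord _ _ _ _ cf (ltW uv) (ltW vs); nra.
have fv_lt := cvgr_lt _ (fa_cvg _ Dv) ((f u + f v) / 2) ltac:(lra).
have fu_gt := cvgr_gt _ (fa_cvg _ Du) ((f u + f v) / 2) ltac:(lra).
(* The midpoint of [f v] and [f u] separates the values of [fa a] at [v] and [u]
   as soon as both are close to their limits. *)
near=> a => m fam.
apply: (lt_trans tu); rewrite ltNge; apply/negP => mu.
have favu : fa a v < fa a u.
  by apply: (@lt_trans _ _ ((f u + f v) / 2)); near: a.
have famv : fa a m <= fa a v by move/argminP: fam.
have := convex_chord _ _ _ _ (cfa a) mu (ltW uv); nra.
Unshelve. all: by end_near. Qed.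

Lemma near_argmin_lt {T : Type} (F : set_system T) {FF : Filter F}
    (D : set R) f (fa : T -> R -> R) s t :
  (forall x y, x < y -> exists2 u, D u & x < u < y) ->
  convex_functions f -> (forall a, convex_functions (fa a)) ->
  (forall u, D u -> fa a u @[a --> F] --> f u) ->
  argmin f s -> ubound (argmin f) s -> s < t ->
  \forall a \near F, forall m, argmin (fa a) m -> m < t.
Proof.
move=> D_btw cf cfa fa_cvg fs ubs st.
have : \forall a \near F, forall m, argmin (fa a \o -%R) m -> - t < m.
  apply: (@near_argmin_gt _ _ _ [set u | D (- u)] (f \o -%R) _ (- s)).
  - move=> x y xy; have [|u Du uxy] := D_btw (- y) (- x); first by lra.
    by exists (- u); [rewrite /= opprK|lra].
  - exact: convex_functions_opp.
  - by move=> a; exact: convex_functions_opp.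
  - by move=> u Du; exact: fa_cvg.
  - by apply/argmin_opp; rewrite opprK.
  - by move=> u /argmin_opp /ubs; rewrite lerNl.
  - by rewrite ltrN2.
apply: filterS => a fa_gt m fam.
by rewrite -ltrN2; apply: fa_gt; apply/argmin_opp; rewrite opprK.
Qed.

End ConvexMinimizers.

(** * Limits along nets *)

Section NetLimits.
Context {I : Type} {le : I -> I -> Prop} (le_directed : directed le).

Lemma net_filter_filter : Filter (net_filter le).
Proof.
have [[i _] _ le_trans le_up] := le_directed.
apply: filter_from_filter; first by exists i.
move=> a b _ _; have [c [ac bc]] := le_up a b.
by exists c => // e ce; split; [exact: le_trans ac ce|exact: le_trans bc ce].
Qed.

Lemma net_liminf_ge {R : realType} (y : I -> R) (s : R) :
  (forall t, t < s -> \forall a \near net_filter le, t < y a) ->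
  (s%:E <= net_liminf le y)%E.
Proof.
move=> y_gt; apply/lee_subgt0Pr => e e0.
have [a _ ya] := y_gt (s - e) ltac:(lra).
apply: (@le_trans _ _ (ereal_inf [set (y b)%:E | b in [set b | le a b]])).
  by apply/ereal_infP => _ [b /ya/= yb <-]; rewrite lee_fin ltW.
by apply: ereal_sup_ubound; exists a.
Qed.

Lemma net_limsup_le {R : realType} (y : I -> R) (s : R) :
  (forall t, s < t -> \forall a \near net_filter le, y a < t) ->
  (net_limsup le y <= s%:E)%E.
Proof.
move=> y_lt; apply/lee_addgt0Pr => e e0.
have [a _ ya] := y_lt (s + e) ltac:(lra).
apply: (@le_trans _ _ (ereal_sup [set (y b)%:E | b in [set b | le a b]])).
  by apply: ereal_inf_lbound; exists a.
by apply/ereal_supP => _ [b /ya/= yb <-]; rewrite lee_fin ltW.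
Qed.

Lemma cvg_of_near_ltgt {R : realType} {F : set_system I} {FF : Filter F}
    (y : I -> R) (s : R) :
  (forall t, t < s -> \forall a \near F, t < y a) ->
  (forall t, s < t -> \forall a \near F, y a < t) ->
  y a @[a --> F] --> s.
Proof.
move=> y_gt y_lt; apply/cvgrPdist_lt => e e0.
have y_gt_e := y_gt (s - e) ltac:(lra).
have y_lt_e := y_lt (s + e) ltac:(lra).
near=> a; rewrite distrC ltr_distl; apply/andP; split; near: a => //.
Unshelve. all: by end_near. Qed.

End NetLimits.

(** * Almost sure events on a complete probability space *)

Section AlmostSurely.
Context {d : measure_display} {Omega : measurableType d} {R : realType}.
Context {P : probability Omega R} (P_complete : measure_is_complete P).

(** Completeness supplies the measurability that [almost_surely] demands, so
    that events can be combined and enlarged as in a filter. *)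
Lemma almost_surelyP (E : set Omega) :
  almost_surely P E <-> {ae P, forall w, E w}.
Proof.
have nullC : measurable E -> P.-negligible (~` E) <-> P E = 1%E.
  move=> mE; rewrite negligibleP; last exact: measurableC.
  have PC := probability_setC P mE.
  split=> [nE|PE]; last by apply: (etrans PC); rewrite PE subee.
  have /eqP : (1 - P E = 0)%E by rewrite -PC.
  by rewrite sube_eq ?add0e// ?fin_num_measure// => /eqP <-.
split=> [[mE /nullC]|nE]; first exact.
have mE : measurable E by rewrite -(setCK E); apply/measurableC/P_complete.
by split=> //; exact/nullC.
Qed.

Lemma ae_countable {T : Type} (D : set T) (E : T -> Omega -> Prop) :
  countable D -> (forall t, D t -> {ae P, forall w, E t w}) ->
  {ae P, forall w, forall t, D t -> E t w}.
Proof.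
move=> /countable_injP[h h_inj] aeE.
have : {ae P, forall w, forall n, forall t, D t -> h t = n -> E t w}.
  apply: ae_foralln => n.
  (* At most one point of [D] has code [n]. *)
  have [[t [Dt <-]]|noh] := pselect (exists t, D t /\ h t = n).
    by apply: filterS (aeE t Dt) => w Ew u Du /h_inj -> //; rewrite inE.
  by apply: aeW => w t Dt htn; case: noh; exists t.
by apply: filterS => w Ew t Dt; exact: Ew.
Qed.

End AlmostSurely.

(** * The limit theorem *)

Theorem theorem9 (R : realType) (d : measure_display) (Omega : measurableType d)
  (P : probability Omega R) (P_complete : measure_is_complete P)
  (I : Type) (le : I -> I -> Prop) (le_directed : directed le)
  (U : set (R -> R)) (U_convex : U `<=` convex_functions)
  (Z : Omega -> R -> R) (Za : I -> Omega -> R -> R)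
  (Z_U : process_in U Z) (Za_U : forall a, process_in U (Za a))
  (D : set R) (D_countable : countable D) (D_dense : dense D)
  (Za_cvg : forall t, D t ->
     almost_surely P [set w | Za a w t @[a --> net_filter le] --> Z w t]) :
  (U = cvxS ->
     almost_surely P [set w | ((argmin_min (Z w))%:E <=
       net_liminf le (fun a => argmin_min (Za a w)))%E]) /\
  (U = cvxS' ->
     almost_surely P [set w | (net_limsup le (fun a => argmin_max (Za a w)) <=
       (argmin_max (Z w))%:E)%E]) /\
  (U = cvxSstar -> almost_surely P [set w | cvxSu (Z w)] ->
     almost_surely P
       [set w | argmin_min (Za a w) @[a --> net_filter le] --> argmin_min (Z w)
             /\ argmin_min (Z w) = argmin_max (Z w)] /\
     almost_surely P
       [set w | argmin_max (Za a w) @[a --> net_filter le] --> argmin_max (Z w)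
             /\ argmin_max (Z w) = argmin_min (Z w)]) /\
  (U = cvxSstar -> forall xi : (R -> R) -> R, measurable_selection xi ->
     [/\ almost_surely P [set w | ((argmin_min (Z w))%:E <=
           net_liminf le (fun a => xi (Za a w)))%E],
         almost_surely P [set w | (net_limsup le (fun a => xi (Za a w)) <=
           (argmin_max (Z w))%:E)%E] &
         almost_surely P [set w | cvxSu (Z w)] ->
         almost_surely P
           [set w | xi (Za a w) @[a --> net_filter le] --> argmin_min (Z w)
                 /\ argmin_min (Z w) = argmin_max (Z w)]]).
Proof.
have FF := net_filter_filter le_directed.
have D_btw x y : x < y -> exists2 t, D t & x < t < y by exact: dense_itv.
have cZ w : convex_functions (Z w) by exact: U_convex (Z_U.2 w).
have cZa a w : convex_functions (Za a w) by exact: U_convex ((Za_U a).2 w).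
have ae_cvg : {ae P, forall w, forall t, D t ->
    Za a w t @[a --> net_filter le] --> Z w t}.
  by apply: ae_countable => // t /Za_cvg/(almost_surelyP P_complete).
(* Stating the bounds for an arbitrary choice [y] of minimizers lets the least
   minimizer, the greatest one and [xi] be treated alike. *)
have near_gt (y : I -> Omega -> R) : (forall a w, argmin (Za a w) (y a w)) ->
    (forall w, cvxS (Z w)) ->
    {ae P, forall w, forall t, t < argmin_min (Z w) ->
       \forall a \near net_filter le, t < y a w}.
  move=> ymin ZS; apply: filterS ae_cvg => w cvg_w t tZ.
  have [minZ lbZ] := argmin_minP _ (ZS w).
  have := @near_argmin_gt _ _ _ FF _ _ _ _ _ D_btw (cZ w) (cZa^~ w) cvg_w minZ lbZ tZ.
  by apply: filterS => a /(_ _ (ymin a w)).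
have near_lt (y : I -> Omega -> R) : (forall a w, argmin (Za a w) (y a w)) ->
    (forall w, cvxS' (Z w)) ->
    {ae P, forall w, forall t, argmin_max (Z w) < t ->
       \forall a \near net_filter le, y a w < t}.
  move=> ymin ZS; apply: filterS ae_cvg => w cvg_w t tZ.
  have [maxZ ubZ] := argmin_maxP _ (ZS w).
  have := @near_argmin_lt _ _ _ FF _ _ _ _ _ D_btw (cZ w) (cZa^~ w) cvg_w maxZ ubZ tZ.
  by apply: filterS => a /(_ _ (ymin a w)).
have unique_cvg (y : I -> Omega -> R) : U = cvxSstar ->
    (forall a w, argmin (Za a w) (y a w)) ->
    almost_surely P [set w | cvxSu (Z w)] ->
    {ae P, forall w, (y a w @[a --> net_filter le] --> argmin_min (Z w)) /\
                     argmin_min (Z w) = argmin_max (Z w)}.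
  move=> US ymin /(almost_surelyP P_complete) ZSu.
  have ZS w : cvxSstar (Z w) by rewrite -US; exact: Z_U.2.
  have y_gt := near_gt y ymin (fun w => (ZS w).1).
  have y_lt := near_lt y ymin (fun w => (ZS w).2).
  apply: filterS3 ZSu y_gt y_lt => w Zu gt_w lt_w.
  have minmax := argmin_min_max_unique _ (ZS w) Zu.
  by split=> //; apply: cvg_of_near_ltgt => //; rewrite minmax.
split=> [US|].
  apply/(almost_surelyP P_complete).
  have Za_min a w : argmin (Za a w) (argmin_min (Za a w)).
    have : cvxS (Za a w) by rewrite -US; exact: (Za_U a).2.
    by case/argmin_minP.
  apply: filterS (near_gt _ Za_min _) => [w|w]; first exact: net_liminf_ge.
  by rewrite -US; exact: Z_U.2.
split=> [US|].
  apply/(almost_surelyP P_complete).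
  have Za_max a w : argmin (Za a w) (argmin_max (Za a w)).
    have : cvxS' (Za a w) by rewrite -US; exact: (Za_U a).2.
    by case/argmin_maxP.
  apply: filterS (near_lt _ Za_max _) => [w|w]; first exact: net_limsup_le.
  by rewrite -US; exact: Z_U.2.
split=> [US ZSu|US xi [_ xi_min]].
  have Za_S a w : cvxSstar (Za a w) by rewrite -US; exact: (Za_U a).2.
  split; apply/(almost_surelyP P_complete).
    apply: (unique_cvg (fun a w => argmin_min (Za a w)) US _ ZSu) => a w.
    exact: (argmin_minP _ (Za_S a w).1).1.
  have := unique_cvg (fun a w => argmin_max (Za a w)) US
    (fun a w => (argmin_maxP _ (Za_S a w).2).1) ZSu.
  by apply: filterS => w [cvg_w eq_w]; rewrite /= -eq_w.
have xi_sel a w : argmin (Za a w) (xi (Za a w)).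
  by apply: xi_min; rewrite -US; exact: (Za_U a).2.
have ZS w : cvxSstar (Z w) by rewrite -US; exact: Z_U.2.
split.
- apply/(almost_surelyP P_complete).
  have := near_gt _ xi_sel (fun w => (ZS w).1).
  by apply: filterS => w; exact: net_liminf_ge.
- apply/(almost_surelyP P_complete).
  have := near_lt _ xi_sel (fun w => (ZS w).2).
  by apply: filterS => w; exact: net_limsup_le.
- move=> ZSu; apply/(almost_surelyP P_complete).
  exact: (unique_cvg (fun a w => xi (Za a w)) US xi_sel ZSu).
Qed.
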